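(* For values of the investment parameters $(\mu_I,\sigma_I,\lambda_I,m_I)$ such that $\rho>\mu_I$ and $h(\boldsymbol{\varsigma})>\sigma_I^2$ hold, the investment threshold $q^\star(\boldsymbol{\varrho})$ defined in the context: (1) decreases with the investment drift $\mu_I$; (2) increases with the investment volatility $\sigma_I$ and with the investment jump intensity $\lambda_I$; (3) is not monotonic with respect to the magnitude $m_I$ of the jumps in the investment: it decreases when $m_I\in(-1,0)$ and increases when $m_I>0$.
   Context: Parameters: $\rho>0$, $\theta>0$, $\kappa_1>\kappa_0>0$, $n\ge 0$, $\mu_X,\mu_I\in\mathbb{R}$, $\sigma_X,\sigma_I>0$, $\lambda_X,\lambda_I>0$, and deterministic jump magnitudes $m_X,m_I>-1$. Write $\boldsymbol{\phi_X}=(\mu_X,\sigma_X,\lambda_X,m_X)$, $\boldsymbol{\phi_I}=(\mu_I,\sigma_I,\lambda_I,m_I)$, $\boldsymbol{\varsigma}=(\theta,\rho,\boldsymbol{\phi_X})$, $\boldsymbol{\varrho}=(\theta,\rho,\boldsymbol{\phi_X},\boldsymbol{\phi_I})$. Define $$j(r,\boldsymbol{\varrho})=\left[\frac{\sigma_X^2}{2}\theta^2+\frac{\sigma_I^2}{2}\right]r^2+\left[\left(\mu_X-\frac{\sigma_X^2}{2}-\lambda_X m_X\right)\theta-\left(\mu_I-\frac{\sigma_I^2}{2}-\lambda_I m_I\right)\right]r+(\mu_I-\lambda_I m_I)-(\lambda_X+\lambda_I)-\rho+\lambda_X(1+m_X)^{\theta r}+\lambda_I(1+m_I)^{1-r},$$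 $$h(\boldsymbol{\varsigma})=\rho-\left(\mu_X+(\theta-1)\frac{\sigma_X^2}{2}-\lambda_X m_X\right)\theta-\lambda_X\left((1+m_X)^\theta-1\right),\qquad A(\boldsymbol{\varsigma})=\frac{e^{-h(\boldsymbol{\varsigma})n}}{h(\boldsymbol{\varsigma})}.$$ $r_0(\boldsymbol{\varrho})$ is the (unique) positive root of $r\mapsto j(r,\boldsymbol{\varrho})$, and $$q^\star(\boldsymbol{\varrho})=\frac{1}{(\kappa_1-\kappa_0)A(\boldsymbol{\varsigma})}\,\frac{r_0(\boldsymbol{\varrho})}{r_0(\boldsymbol{\varrho})-1}.$$ ''Increases (decreases) with a parameter'' means $q^\star$ is increasing (decreasing) as a function of that parameter, all other parameters fixed, within the admissible parameter values.
   Formalization: The threshold is shown to increase strictly with the investment jump intensity only when the jump magnitude m_I is nonzero; for m_I = 0 it does not depend on that intensity, and only nondecrease is stated there. *)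

(* Defs.v *)
From mathcomp Require Import all_boot all_order all_algebra.
From mathcomp Require Import classical_sets reals sequences exp.

Set Implicit Arguments.
Unset Strict Implicit.
Unset Printing Implicit Defensive.
Import Order.TTheory GRing.Theory Num.Theory.
Local Open Scope ring_scope.

(* Parameters [(mu, sigma, lambda, m)] of a geometric jump-diffusion with
   deterministic relative jump size [m]. *)
Record jump_diffusion (R : realType) := JumpDiffusion {
  drift : R;
  volatility : R;
  intensity : R;
  magnitude : R }.

Section Threshold.
Variable R : realType.

Definition jfun (theta rho : R) (phiX phiI : jump_diffusion R) (r : R) : R :=
  let: JumpDiffusion muX sigmaX lambdaX mX := phiX in
  let: JumpDiffusion muI sigmaI lambdaI mI := phiI in
  (sigmaX ^+ 2 / 2 * theta ^+ 2 + sigmaI ^+ 2 / 2) * r ^+ 2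
  + ((muX - sigmaX ^+ 2 / 2 - lambdaX * mX) * theta
     - (muI - sigmaI ^+ 2 / 2 - lambdaI * mI)) * r
  + (muI - lambdaI * mI) - (lambdaX + lambdaI) - rho
  + lambdaX * (1 + mX) `^ (theta * r) + lambdaI * (1 + mI) `^ (1 - r).

Definition hfun (theta rho : R) (phiX : jump_diffusion R) : R :=
  let: JumpDiffusion muX sigmaX lambdaX mX := phiX in
  rho - (muX + (theta - 1) * (sigmaX ^+ 2 / 2) - lambdaX * mX) * theta
  - lambdaX * ((1 + mX) `^ theta - 1).

Definition Afun (theta rho : R) (phiX : jump_diffusion R) (n : R) : R :=
  expR (- hfun theta rho phiX * n) / hfun theta rho phiX.

(* The positive root of [jfun]; [xget] selects a member of the set, with the
   junk value 0 when there is none. The root exists and is unique as soon as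
   [drift phiI < rho]: the function is then strictly convex in [r], negative
   at 0 and unbounded above. *)
Definition r0 (theta rho : R) (phiX phiI : jump_diffusion R) : R :=
  xget 0 [set r | 0 < r /\ jfun theta rho phiX phiI r = 0]%classic.

Definition qstar (kappa0 kappa1 n theta rho : R)
    (phiX phiI : jump_diffusion R) : R :=
  1 / ((kappa1 - kappa0) * Afun theta rho phiX n)
  * (r0 theta rho phiX phiI / (r0 theta rho phiX phiI - 1)).

End Threshold.

(* Main.v *)
(* As a function of [r], [j] is convex with [j 0 = mu_I - rho < 0] and
   [j 1 = sigma_I ^ 2 - h < 0]. By convexity it is therefore negative on
   [[0, r0[], so [r0 > 1], and raising [j] on [r > 1] moves [r0] to the left
   and raises [q^* = C r0 / (r0 - 1)]. It remains to see how [j r], for a fixed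
   [r > 1], depends on each parameter: it is affine in [mu_I] with slope
   [1 - r], in [sigma_I ^ 2] with slope [(r ^ 2 + r) / 2], in [lambda_I] with
   slope [(1 + m_I) ^ (1 - r) - (1 - (r - 1) m_I)], which is nonnegative by
   Bernoulli's inequality, and it is convex in [m_I] with minimum at [0]. *)
Require Import Defs.
From mathcomp Require Import all_boot all_order all_algebra.
From mathcomp Require Import classical_sets reals sequences exp.
From mathcomp Require Import topology normedtype ring lra.

Set Implicit Arguments.
Unset Strict Implicit.
Unset Printing Implicit Defensive.
Import Order.TTheory GRing.Theory Num.Theory.
Import numFieldNormedType.Exports.
Local Open Scope ring_scope.

(** * Convexity inequalities for real powers *)

(** Average the tangent bounds of [expR] at [w = t * u * ln x], taken at [0] and [u * ln x] with
    weights [1 - t] and [t]: [w] is the mean of the two points, so the linear terms cancel. *)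
Lemma powR_chord (R : realType) (x t u : R) : 0 < x -> 0 <= t -> t <= 1 ->
  x `^ (t * u) <= (1 - t) + t * x `^ u.
Proof.
move=> x_gt0 t_ge0 t_le1; rewrite /powR gt_eqF //.
set w := t * u * ln x.
have tangent v : expR w * (1 + (v - w)) <= expR v.
  by rewrite -[in leRHS](subrKC w v) expRD ler_pM2l ?expR_gt0 ?expR_ge1Dx.
have := ler_wpM2l t_ge0 (tangent (u * ln x)).
have := ler_wpM2l (_ : 0 <= 1 - t) (tangent 0).
rewrite subr_ge0 expR0 mulr1 => /(_ t_le1) h0 h1.
apply: le_trans (lerD h0 h1); rewrite le_eqVlt; apply/orP; left; apply/eqP.
by rewrite /w; ring.
Qed.

(** Chain [expR v > 1 + v] at [v = - p * ln x], nonzero as [x != 1], with [ln x <= x - 1]. *)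
Lemma bernoulliN (R : realType) (x p : R) : 0 < x -> x != 1 -> 0 < p ->
  1 - p * (x - 1) < x `^ (- p).
Proof.
move=> x_gt0 x_neq1 p_gt0; rewrite /powR gt_eqF //.
have lnx_neq0 : - p * ln x != 0.
  by rewrite mulf_neq0 ?oppr_eq0 ?ln_eq0 // gt_eqF.
apply: le_lt_trans (expR_gt1Dx lnx_neq0).
rewrite mulNr lerD2l lerN2 ler_pM2l //.
have := @le_ln1Dx R (x - 1); rewrite addrCA subrr addr0; apply; lra.
Qed.

(* The sign condition says that the tangent at [x] of the convex function
   [x ^ (- p) + p x] rises from [x] to [y]. *)
Lemma powRN_add_linear_lt (R : realType) (x y p : R) : 0 < x -> 0 < y ->
  0 < p -> 0 < (y - x) * (1 - x `^ (- p - 1)) ->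
  x `^ (- p) + p * x < y `^ (- p) + p * y.
Proof.
move=> x_gt0 y_gt0 p_gt0 slope_gt0.
have yx_neq1 : y / x != 1.
  apply/eqP => /divr1_eq yx; move: slope_gt0; rewrite yx; lra.
(* Bernoulli for the ratio [y / x], scaled by [x ^ (- p)], is the strict tangent inequality at
   [x]. *)
have := bernoulliN (divr_gt0 y_gt0 x_gt0) yx_neq1 p_gt0.
rewrite -(ltr_pM2l (powR_gt0 (- p) x_gt0)) -powRM ?divr_ge0 ?ltW //.
rewrite mulrC [x * _]mulrC divfK ?gt_eqF // => tangent.
have powE : x `^ (- p) = x * x `^ (- p - 1).
  rewrite -{2}[x]powRr1 ?ltW // -powRD; first by congr (_ `^ _); ring.
  by rewrite (gt_eqF x_gt0) implybT.
have := mulr_gt0 p_gt0 slope_gt0.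
have : (1 - p * (y / x - 1)) * x `^ (- p)
       = x `^ (- p) - p * (y - x) * x `^ (- p - 1).
  by rewrite !powE; field; rewrite gt_eqF.
nra.
Qed.

(** * Convexity of [j] in [r] and its positive root *)

Section Root.
Context {R : realType}.
Implicit Types (theta rho r s t : R) (phiX phiI : jump_diffusion R).

(** The last two conditions say that [j] is negative at [0] and at [1]; the others make [j] convex
    and unbounded above. *)
Definition admissible theta rho phiX phiI :=
  [&& 0 <= intensity phiX, -1 < magnitude phiX,
      0 < volatility phiI, 0 <= intensity phiI, -1 < magnitude phiI,
      drift phiI < rho & volatility phiI ^+ 2 < hfun theta rho phiX].

Lemma jfun0 theta rho phiX phiI : -1 < magnitude phiI ->
  jfun theta rho phiX phiI 0 = drift phiI - rho.
Proof.
case: phiX phiI => [muX sX lX mX] [muI sI lI mI] /= mI_gtN1.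
rewrite !mulr0 powRr0 subr0 powRr1; first ring.
lra.
Qed.

Lemma jfun1 theta rho phiX phiI :
  jfun theta rho phiX phiI 1 = volatility phiI ^+ 2 - hfun theta rho phiX.
Proof.
case: phiX phiI => [muX sX lX mX] [muI sI lI mI] /=.
by rewrite !mulr1 subrr powRr0; field.
Qed.

(** Convexity, restricted to chords starting at [0], where the sign of [j] is known. *)
Lemma jfun_chord theta rho phiX phiI t s :
  admissible theta rho phiX phiI -> 0 <= t -> t <= 1 ->
  jfun theta rho phiX phiI (t * s) <=
  (1 - t) * jfun theta rho phiX phiI 0 + t * jfun theta rho phiX phiI s.
Proof.
case: phiX phiI => [muX sX lX mX] [muI sI lI mI].
case/and5P=> /= lX_ge0 mX_gtN1 sI_gt0 lI_ge0 /and3P[mI_gtN1 _ _] t_ge0 t_le1.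
have mX1_gt0 : 0 < 1 + mX by lra.
have mI1_gt0 : 0 < 1 + mI by lra.
(* [powR_chord] needs an exponent proportional to [t], so the [1] is factored out. *)
have split u : (1 + mI) `^ (1 - u) = (1 + mI) * (1 + mI) `^ (- u).
  by rewrite powRD ?powRr1 ?ltW // (gt_eqF mI1_gt0) implybT.
have := ler_wpM2l lX_ge0 (powR_chord (theta * s) mX1_gt0 t_ge0 t_le1).
have := ler_wpM2l (mulr_ge0 lI_ge0 (ltW mI1_gt0))
  (powR_chord (- s) mI1_gt0 t_ge0 t_le1).
rewrite !split !mulr0 oppr0 !powRr0 mulrN [t * (theta * s)]mulrCA.
(* This is the gap between chord and value for the quadratic term. *)
have : 0 <= (sX ^+ 2 / 2 * theta ^+ 2 + sI ^+ 2 / 2) * (t * (1 - t) * s ^+ 2).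
  apply: mulr_ge0; last by rewrite mulr_ge0 ?sqr_ge0 ?mulr_ge0 ?subr_ge0.
  have half2_ge0 (x : R) : 0 <= x ^+ 2 / 2 by rewrite divr_ge0 ?sqr_ge0.
  by rewrite addr_ge0 // mulr_ge0 ?sqr_ge0.
lra.
Qed.

Lemma jfun_continuous theta rho phiX phiI :
  -1 < magnitude phiX -> -1 < magnitude phiI ->
  continuous (jfun theta rho phiX phiI).
Proof.
case: phiX phiI => [muX sX lX mX] [muI sI lI mI] /= mX_gtN1 mI_gtN1 r.
have idc : {for r, continuous (fun x : R => x)} by exact: cvg_id.
have cst (c : R) : {for r, continuous (fun=> c)} by exact: cvg_cst.
have pow (b : R) (g : R -> R) : -1 < b -> {for r, continuous g} ->
    {for r, continuous (fun x => (1 + b) `^ g x)}.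
  move=> b_gtN1 gc; rewrite /powR gt_eqF; last by lra.
  apply: (@continuous_comp _ _ _ (fun x => g x * ln (1 + b)) expR).
    by apply: cvgM; [exact: gc | exact: cst].
  exact: continuous_expR.
have scale (c : R) (g : R -> R) : {for r, continuous g} ->
    {for r, continuous (fun x => c * g x)}.
  by move=> gc; apply: cvgM; [exact: cst | exact: gc].
apply: cvgD; last first.
  by apply: scale; apply: pow => //; apply: cvgB; [exact: cst | exact: idc].
apply: cvgD; last first.
  by apply: (scale); apply: pow => //; apply: scale; exact: idc.
do 3 (apply: cvgD; last exact: cst).
apply: cvgD; last exact: (scale _ id idc).
by apply: (scale _ (fun x => x ^+ 2)); exact: (cvgM idc idc).
Qed.

Lemma jfun_root theta rho phiX phiI : admissible theta rho phiX phiI ->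
  exists r, 0 < r /\ jfun theta rho phiX phiI r = 0.
Proof.
move=> adm; have /and5P[lX_ge0 mX_gtN1 sI_gt0 lI_ge0] := adm.
case/and3P=> mI_gtN1 mu_lt _.
have j0 := jfun0 theta rho phiX mI_gtN1.
have [s [s_ge0 js_ge0]] : exists s, 0 <= s /\ 0 <= jfun theta rho phiX phiI s.
  case: phiX phiI lX_ge0 mX_gtN1 sI_gt0 lI_ge0 mI_gtN1 {mu_lt adm j0}
    => [muX sX lX mX] [muI sI lI mI] /= lX_ge0 _ sI_gt0 lI_ge0 _.
  pose a := sX ^+ 2 / 2 * theta ^+ 2 + sI ^+ 2 / 2.
  pose b := (muX - sX ^+ 2 / 2 - lX * mX) * theta
            - (muI - sI ^+ 2 / 2 - lI * mI).
  have a_gt0 : 0 < a.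
    rewrite ltr_wpDl ?divr_gt0 ?exprn_gt0 //.
    by rewrite mulr_ge0 ?divr_ge0 ?sqr_ge0.
  pose c := muI - lI * mI - (lX + lI) - rho.
  (* Chosen so that [s >= 1] and [a * s >= |b| + |c|], whence [a * s ^ 2] absorbs [b * s + c]; the
     power terms are nonnegative. *)
  pose s := 1 + (`|b| + `|c|) / a.
  have q_ge0 : 0 <= (`|b| + `|c|) / a.
    by rewrite divr_ge0 ?(ltW a_gt0) // addr_ge0.
  exists s; split; first by rewrite /s; lra.
  have as_gt : `|b| + `|c| <= a * s.
    by rewrite /s mulrDr mulr1 mulrC divfK ?gt_eqF //; lra.
  have p1 := mulr_ge0 lX_ge0 (powR_ge0 (1 + mX) (theta * s)).
  have p2 := mulr_ge0 lI_ge0 (powR_ge0 (1 + mI) (1 - s)).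
  have s_ge1 : 1 <= s by rewrite /s; lra.
  have := ler_norm (- b); have := ler_norm (- c); rewrite !normrN => hc hb.
  have s_ge0 : 0 <= s by lra.
  have := ler_wpM2l s_ge0 as_gt; have := ler_wpM2l s_ge0 hb.
  have := ler_wpM2l (normr_ge0 c) s_ge1 => cs bs abcs.
  have : 0 <= a * s ^+ 2 + b * s + c by lra.
  rewrite /a /b /c; lra.
have [|r /[!in_itv]/= /andP[r_ge0 _] jr] :=
    @IVT R (jfun theta rho phiX phiI) 0 s 0 s_ge0
      (continuous_subspaceT (jfun_continuous mX_gtN1 mI_gtN1)).
  by rewrite ge_min le_max j0 js_ge0 orbT andbT subr_le0 ltW.
exists r; split => //; rewrite lt_def r_ge0 andbT.
by apply/eqP => r0E; move: jr; rewrite r0E j0; lra.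
Qed.

Lemma r0P theta rho phiX phiI : admissible theta rho phiX phiI ->
  1 < r0 theta rho phiX phiI /\
  jfun theta rho phiX phiI (r0 theta rho phiX phiI) = 0.
Proof.
(* Existence of a root rules out the default value of [xget]. *)
move=> adm; have [] := xgetPex 0 (jfun_root adm); rewrite -/(r0 _ _ _ _).
set r := r0 _ _ _ _ => r_gt0 jr; split => //.
rewrite ltNge; apply/negP => r_le1.
(* A root in []0, 1]] would lie under a chord joining two negative values. *)
have := jfun_chord 1 adm (ltW r_gt0) r_le1.
have /and5P[_ _ _ _ /and3P[mI_gtN1 mu_lt h_gt]] := adm.
rewrite mulr1 jr jfun1 jfun0 //; nra.
Qed.

Lemma jfun_lt0 theta rho phiX phiI r : admissible theta rho phiX phiI ->
  0 <= r -> r < r0 theta rho phiX phiI -> jfun theta rho phiX phiI r < 0.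
Proof.
move=> adm r_ge0 r_lt; have [s_gt1 js] := r0P adm.
move: r_lt s_gt1 js; set s := r0 _ _ _ _ => r_lt s_gt1 js.
have s_gt0 : 0 < s by lra.
have q_lt1 : r / s < 1 by rewrite ltr_pdivrMr ?mul1r.
have := jfun_chord s adm (divr_ge0 r_ge0 (ltW s_gt0)) (ltW q_lt1).
have /and5P[_ _ _ _ /and3P[mI_gtN1 mu_lt _]] := adm.
rewrite divfK ?gt_eqF // js jfun0 //; nra.
Qed.

(** If the second root were larger, the second function would be negative at the first root, where
    it dominates [0]. *)
Lemma r0_le theta rho phiX phiI phiI' :
  admissible theta rho phiX phiI -> admissible theta rho phiX phiI' ->
  (forall r, 1 < r ->
     jfun theta rho phiX phiI r <= jfun theta rho phiX phiI' r) ->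
  r0 theta rho phiX phiI' <= r0 theta rho phiX phiI.
Proof.
move=> adm adm' jj'; have [r_gt1 jr] := r0P adm.
rewrite leNgt; apply/negP => /(jfun_lt0 adm').
have := jj' _ r_gt1; rewrite jr => ? /(_ (ltW (lt_trans ltr01 r_gt1))); lra.
Qed.

Lemma r0_lt theta rho phiX phiI phiI' :
  admissible theta rho phiX phiI -> admissible theta rho phiX phiI' ->
  (forall r, 1 < r ->
     jfun theta rho phiX phiI r < jfun theta rho phiX phiI' r) ->
  r0 theta rho phiX phiI' < r0 theta rho phiX phiI.
Proof.
move=> adm adm' jj'; rewrite lt_neqAle r0_le // ?andbT; last first.
  by move=> r /jj'/ltW.
(* A common root would contradict the strict inequality there. *)
apply/eqP => rr'; have [r_gt1 jr] := r0P adm.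
by have := jj' _ r_gt1; rewrite jr -rr' (r0P adm').2 ltxx.
Qed.

(** * From the root to the threshold *)

Lemma qstar_coef_gt0 kappa0 kappa1 n theta rho phiX phiI : kappa0 < kappa1 ->
  admissible theta rho phiX phiI ->
  0 < 1 / ((kappa1 - kappa0) * Afun theta rho phiX n).
Proof.
move=> kappa01 /and5P[_ _ _ _ /and3P[_ _ h_gt]].
have h_gt0 : 0 < hfun theta rho phiX by apply: le_lt_trans h_gt; exact: sqr_ge0.
by rewrite divr_gt0 // mulr_gt0 ?subr_gt0 // divr_gt0 ?expR_gt0.
Qed.

(** In this form the ratio visibly decreases in [r]. *)
Lemma divr_subr1 r : 1 < r -> r / (r - 1) = 1 + (r - 1)^-1.
Proof. by move=> r_gt1; field; rewrite subr_eq0 gt_eqF. Qed.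

Lemma qstar_le kappa0 kappa1 n theta rho phiX phiI phiI' : kappa0 < kappa1 ->
  admissible theta rho phiX phiI -> admissible theta rho phiX phiI' ->
  (forall r, 1 < r ->
     jfun theta rho phiX phiI r <= jfun theta rho phiX phiI' r) ->
  qstar kappa0 kappa1 n theta rho phiX phiI
  <= qstar kappa0 kappa1 n theta rho phiX phiI'.
Proof.
move=> kappa01 adm adm' jj'; have [r_gt1 _] := r0P adm.
have [r'_gt1 _] := r0P adm'.
rewrite /qstar ler_pM2l ?(qstar_coef_gt0 n kappa01 adm) // !divr_subr1 //.
by rewrite lerD2l lef_pV2 ?posrE ?subr_gt0 // lerD2r r0_le.
Qed.

Lemma qstar_lt kappa0 kappa1 n theta rho phiX phiI phiI' : kappa0 < kappa1 ->
  admissible theta rho phiX phiI -> admissible theta rho phiX phiI' ->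
  (forall r, 1 < r ->
     jfun theta rho phiX phiI r < jfun theta rho phiX phiI' r) ->
  qstar kappa0 kappa1 n theta rho phiX phiI
  < qstar kappa0 kappa1 n theta rho phiX phiI'.
Proof.
move=> kappa01 adm adm' jj'; have [r_gt1 _] := r0P adm.
have [r'_gt1 _] := r0P adm'.
rewrite /qstar ltr_pM2l ?(qstar_coef_gt0 n kappa01 adm) // !divr_subr1 //.
by rewrite ltrD2l ltf_pV2 ?posrE ?subr_gt0 // ltrD2r r0_lt.
Qed.

(** Up to terms free of [m], [j] is [lambda] times [x ^ (- p) + p * x] with [x = 1 + m] and
    [p = r - 1]. *)
Lemma jfun_magnitude_lt theta rho phiX (mu sigma lambda m m' r : R) :
  0 < lambda -> -1 < m -> -1 < m' -> 1 < r ->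
  0 < (m' - m) * (1 - (1 + m) `^ (- r)) ->
  jfun theta rho phiX (JumpDiffusion mu sigma lambda m) r
  < jfun theta rho phiX (JumpDiffusion mu sigma lambda m') r.
Proof.
case: phiX => [muX sX lX mX] lambda_gt0 m_gtN1 m'_gtN1 r_gt1 slope.
have : (1 + m) `^ (- (r - 1)) + (r - 1) * (1 + m)
       < (1 + m') `^ (- (r - 1)) + (r - 1) * (1 + m').
  apply: powRN_add_linear_lt; try lra.
  have -> : - (r - 1) - 1 = - r by ring.
  by have -> : 1 + m' - (1 + m) = m' - m by ring.
rewrite -(ltr_pM2l lambda_gt0) opprB /=; lra.
Qed.

End Root.

Theorem proposition4 (R : realType) (rho theta kappa0 kappa1 n : R)
    (muX sigmaX lambdaX mX muI sigmaI lambdaI mI : R)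
    (rho_gt0 : 0 < rho) (theta_gt0 : 0 < theta)
    (kappa0_gt0 : 0 < kappa0) (kappa01 : kappa0 < kappa1) (n_ge0 : 0 <= n)
    (sigmaX_gt0 : 0 < sigmaX) (lambdaX_gt0 : 0 < lambdaX) (mX_gtN1 : -1 < mX)
    (sigmaI_gt0 : 0 < sigmaI) (lambdaI_gt0 : 0 < lambdaI) (mI_gtN1 : -1 < mI)
    (muI_lt : muI < rho)
    (h_gt : sigmaI ^+ 2
            < hfun theta rho (JumpDiffusion muX sigmaX lambdaX mX)) :
  let phiX := JumpDiffusion muX sigmaX lambdaX mX in
  let q (mu sigma lambda m : R) :=
    qstar kappa0 kappa1 n theta rho phiX (JumpDiffusion mu sigma lambda m) in
  [/\ (* (1) *)
      {in `]-oo, rho[ &,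
        {homo (fun mu => q mu sigmaI lambdaI mI) : x y /~ x < y}},
      (* (2) *)
      {in [pred sigma | 0 < sigma & sigma ^+ 2 < hfun theta rho phiX] &,
        {homo (fun sigma => q muI sigma lambdaI mI) : x y / x < y}} /\
      ({in `]0, +oo[ &,
         {homo (fun lambda => q muI sigmaI lambda mI) : x y / x <= y}} /\
       (mI != 0 ->
        {in `]0, +oo[ &,
          {homo (fun lambda => q muI sigmaI lambda mI) : x y / x < y}}))
    & (* (3) *)
      (~ {in `]-1, +oo[ &,
           {homo (fun m => q muI sigmaI lambdaI m) : x y / x <= y}} /\
       ~ {in `]-1, +oo[ &,
           {homo (fun m => q muI sigmaI lambdaI m) : x y /~ x <= y}}) /\
      ({in `]-1, 0[ &,
         {homo (fun m => q muI sigmaI lambdaI m) : x y /~ x < y}} /\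
       {in `]0, +oo[ &,
         {homo (fun m => q muI sigmaI lambdaI m) : x y / x < y}})].
Proof.
move=> phiX q.
have adm mu sigma lambda m : mu < rho -> 0 < sigma ->
    sigma ^+ 2 < hfun theta rho phiX -> 0 < lambda -> -1 < m ->
    admissible theta rho phiX (JumpDiffusion mu sigma lambda m).
  move=> mu_lt sigma_gt0 hs lambda_gt0 m_gtN1.
  by rewrite /admissible /= !ltW // mX_gtN1 sigma_gt0 m_gtN1 mu_lt hs.
have lambda_lt x y : mI != 0 -> 0 < x -> x < y -> forall r, 1 < r ->
    jfun theta rho phiX (JumpDiffusion muI sigmaI x mI) r
    < jfun theta rho phiX (JumpDiffusion muI sigmaI y mI) r.
  move=> mI_neq0 x_gt0 xy r r_gt1 /=.
  have := @bernoulliN R (1 + mI) (r - 1).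
  have mI1_gt0 : 0 < 1 + mI by lra.
  have mI1_neq1 : 1 + mI != 1 by rewrite -subr_eq0 addrAC subrr add0r.
  move=> /(_ mI1_gt0 mI1_neq1); rewrite opprB subr_gt0 => /(_ r_gt1) b.
  have : 0 < (y - x) * ((1 + mI) `^ (1 - r) - (1 - (r - 1) * (1 + mI - 1))).
    by rewrite mulr_gt0 // subr_gt0.
  lra.
have mneg : {in `]-1, 0[ &,
    {homo (fun m => q muI sigmaI lambdaI m) : x y /~ x < y}}.
  move=> x y /[!in_itv]/= /andP[x_gtN1 x_lt0] /andP[y_gtN1 y_lt0] yx.
  apply: qstar_lt => //; try exact: adm.
  move=> r r_gt1; apply: jfun_magnitude_lt => //.
  (* Bernoulli gives [(1 + x) ^ (- r) > 1 - r * x > 1], so both factors of the slope condition are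
     negative. *)
  have := @bernoulliN R (1 + x) r; rewrite -subr_eq0 addrAC subrr add0r.
  have x1_gt0 : 0 < 1 + x by lra.
  move=> /(_ x1_gt0 (negbT (lt_eqF x_lt0)) (lt_trans ltr01 r_gt1)) b.
  have rx : r * x < 0 by rewrite nmulr_llt0 //; lra.
  rewrite nmulr_rgt0 ?subr_lt0 //; lra.
have mpos : {in `]0, +oo[ &,
    {homo (fun m => q muI sigmaI lambdaI m) : x y / x < y}}.
  move=> x y /[!in_itv]/= /[!andbT] x_gt0 y_gt0 xy.
  apply: qstar_lt => //; try by apply: adm => //; lra.
  move=> r r_gt1; apply: jfun_magnitude_lt => //; try lra.
  rewrite mulr_gt0 ?subr_gt0 // powRN invf_lt1 ?powR_gt0; try lra.
  have : 1 + x <= (1 + x) `^ r by rewrite le1r_powR //; lra.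
  lra.
split.
- move=> x y /[!in_itv]/= x_lt y_lt xy; apply: qstar_lt => //; try exact: adm.
  move=> r r_gt1 /=.
  have : 0 < (x - y) * (r - 1) by rewrite mulr_gt0 ?subr_gt0.
  lra.
- split.
    move=> x y /andP[/= x_gt0 hx] /andP[/= y_gt0 hy] xy.
    apply: qstar_lt => //; try exact: adm.
    move=> r r_gt1 /=.
    have sq : x ^+ 2 < y ^+ 2 by rewrite ltr_pXn2r ?nnegrE ?ltW.
    have : 0 < (y ^+ 2 - x ^+ 2) * (r * (r + 1)).
      by rewrite mulr_gt0 ?subr_gt0 // mulr_gt0 //; lra.
    lra.
  split=> [|mI_neq0] x y /[!in_itv]/= /[!andbT] x_gt0 y_gt0 xy; last first.
    by apply: qstar_lt => //; [exact: adm|exact: adm|exact: lambda_lt].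
  apply: qstar_le => //; try exact: adm.
  move=> r r_gt1; move: xy; rewrite le_eqVlt => /orP[/eqP->//|xy].
  (* When [mI = 0] the intensity cancels out of [j], which leaves only weak monotonicity. *)
  have [mI0|mI_neq0] := eqVneq mI 0; last exact/ltW/lambda_lt.
  by rewrite /= mI0 addr0 powR1; lra.
- split=> //; split=> mono.
    (* Two points of the strictly decreasing branch refute growth on the whole range; below, [1] and
       [2] on the increasing branch refute decrease. *)
    have [lo hi] : (- (2 / 3) \in `]-1 : R, 0[) /\ (- (1 / 3) \in `]-1 : R, 0[).
      by rewrite !in_itv /=; split; apply/andP; split; lra.
    have lt : - (2 / 3) < - (1 / 3) :> R by lra.
    have sub z : z \in `]-1, 0[ -> z \in `]-1 : R, +oo[.
      by rewrite !in_itv /= andbT => /andP[].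
    have := le_lt_trans (mono _ _ (sub _ lo) (sub _ hi) (ltW lt))
      (mneg _ _ hi lo lt).
    by rewrite ltxx.
  have [lo hi] : (1 \in `]0 : R, +oo[) /\ (2 \in `]0 : R, +oo[).
    by rewrite !in_itv /= !andbT; split; lra.
  have lt : 1 < 2 :> R by lra.
  have sub z : z \in `]0, +oo[ -> z \in `]-1 : R, +oo[.
    by rewrite !in_itv /= !andbT; lra.
  have := le_lt_trans (mono _ _ (sub _ hi) (sub _ lo) (ltW lt))
    (mpos _ _ lo hi lt).
  by rewrite ltxx.
Qed.
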